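(* There exists an absolute constant $c<\infty$ such that the following holds. Let $(\mathcal{F}_n)_{n\ge0}$ be a filtration on a probability space, let $Q^1_n$ and $Q^2_n$ ($n\ge 0$) be two adapted nonnegative increasing sequences of random variables, let $Q_n=Q^1_n-Q^2_n$, and suppose $(H_n)_{n\ge0}$ is such that $H_n+Q_n$ is a martingale that is $0$ at time $0$. Put $$Z=\sup_n|H_n|,\qquad Y=\sup_{n\ge 1}\,[(Q^1_n-Q^1_{n-1})+(Q^2_n-Q^2_{n-1})],\qquad W=Q^1_\infty+Q^2_\infty .$$ Then for $p>1$ $$\mathbb{E}\sup_n|Q_n|^{2p}\le c\,p^{4p}\Big[\mathbb{E}Z^{2p}+(\mathbb{E}Z^{2p})^{1/2}(\mathbb{E}W^{2p})^{1/2}+(\mathbb{E}Y^{2p})^{1/2}(\mathbb{E}W^{2p})^{1/2}\Big].$$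
   Context: $Q^i_\infty=\sup_n Q^i_n=\lim_n Q^i_n$ for $i=1,2$. ''Increasing'' means nondecreasing in $n$ (almost surely). *)

(* Defs.v *)
From HB Require Import structures.
From mathcomp Require Import all_boot all_order all_algebra.
From mathcomp Require Import all_classical all_reals all_analysis.
Set Implicit Arguments.
Unset Strict Implicit.
Unset Printing Implicit Defensive.
Import Order.TTheory GRing.Theory Num.Theory.
Import numFieldNormedType.Exports.
Local Open Scope classical_set_scope.
Local Open Scope ring_scope.

Definition filtration (d : measure_display) (T : measurableType d)
    (F : nat -> set (set T)) : Prop :=
  [/\ forall n, sigma_algebra [set: T] (F n),
      forall n, F n `<=` measurable &
      forall m n, (m <= n)%N -> F m `<=` F n].

(* [g_sigma_algebraType G] is [T] with the sigma-algebra generated by [G],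
   which is [G] itself when [G] is a sigma-algebra. *)
Definition measurable_wrt (d : measure_display) (T : measurableType d)
    (R : realType) (G : set (set T)) (X : T -> R) : Prop :=
  measurable_fun [set: g_sigma_algebraType G]
    (X : g_sigma_algebraType G -> R).

Definition adapted (d : measure_display) (T : measurableType d)
    (R : realType) (F : nat -> set (set T)) (X : nat -> T -> R) : Prop :=
  forall n, measurable_wrt (F n) (X n).

(* [Y] is a version of E[X | G], for an integrable [X]. *)
Definition is_cond_exp (d : measure_display) (T : measurableType d)
    (R : realType) (P : probability T R) (G : set (set T))
    (X Y : T -> R) : Prop :=
  [/\ measurable_wrt G Y,
      P.-integrable [set: T] (EFin \o Y) &
      forall A, G A ->
        (\int[P]_(x in A) (Y x)%:E = \int[P]_(x in A) (X x)%:E)%E].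

Definition martingale (d : measure_display) (T : measurableType d)
    (R : realType) (P : probability T R) (F : nat -> set (set T))
    (M : nat -> T -> R) : Prop :=
  [/\ adapted F M,
      forall n, P.-integrable [set: T] (EFin \o M n) &
      forall n, is_cond_exp P (F n) (M n.+1) (M n)].

Definition esup_seq (T : Type) (R : realType) (X : nat -> T -> R) (x : T)
    : \bar R :=
  ereal_sup (range (fun n => (X n x)%:E)).

(* Main.v *)
Require Import Defs.
From HB Require Import structures.
From mathcomp Require Import all_boot all_order all_algebra.
From mathcomp Require Import all_classical all_reals all_analysis.
From mathcomp Require Import finmap measurable_realfun.
From mathcomp Require Import ring lra.
Import Order.TTheory GRing.Theory Num.Theory.
Import numFieldNormedType.Exports.
Local Open Scope classical_set_scope.
Local Open Scope ring_scope.

(** Put r = 2p, M = H + Q, S = sup_k |Q_k| and s = sup_k |M_k| up to a fixed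
    horizon N.  The whole estimate is first proved path by path
    ([pathwise_bound]):

      S^r <= C_r (Z^r + ((Z + Y) W)^p) + sum_k g_k (M_{k+1} - M_k),

    where g_k depends on the path up to time k only.  Taking expectations, the
    sum disappears because M is a martingale ([integral_transform]), the product
    terms are split by Cauchy-Schwarz ([cauchy_schwarz_powR]), and N tends to
    infinity by monotone convergence ([integral_esup_le]).

    The pathwise inequality combines two discrete computations.

    - Itô's formula for |x|^r along Q, with derivative r sgn(x)|x|^{r-1}
      ([pathwise_ito]).  Writing dQ = dM - dH, the first order term is a
      martingale transform minus a sum against dH, and summation by parts
      moves the difference from H to the derivative at Q.  What remains is a
      sum of (H + dQ) d(derivative), and the derivative is Lipschitz with
      constant of order S^{r-2}; as |dQ| sums to at most W, the remainder is at
      most r^2 S^{r-2} (Z + Y) W.  This controls the last value |Q_N|^r.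

    - Doob's maximal inequality in its pathwise form ([pathwise_doob]), which
      replaces the last value |M_N| by the running maximum s at the price of
      another martingale transform.  M is close to Q up to Z, so this gives the
      passage from |Q_N| to S.

    Terms such as S^{r-1} Z and S^{r-2} (Z + Y) W are absorbed into S^r by
    Young's inequality.  The growth p^{4p} of the constant forces some care:
    the passage from |Q_N|^r to S^r may only cost a factor bounded uniformly in
    r, since this factor is afterwards raised to a power of order r.  Therefore
    sums are split as (s + Z)^r <= e s^r + (2rZ)^r and Young's inequality is
    used with the parameter r/(r-1), whose (r-1)-st power is at most e.  The
    resulting constant is of order K^p p^{2p}, and K^p <= e^K p^{2p}
    ([powR_le_expR]).

    When E W^{2p} is infinite, the right-hand side is infinite too, unless Z
    and Y vanish almost surely, in which case Q is constantly zero. *)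

Set Implicit Arguments.
Unset Strict Implicit.
Unset Printing Implicit Defensive.

(** * Inequalities for real powers *)

Section powers.
Context {R : realType}.
Implicit Types (a b s t r x z : R).

(** The graph of the s-th power lies above its tangent at b; equivalently,
    Young's inequality for the exponents s and s/(s-1). *)
Lemma powR_tangent s a b : 1 <= s -> 0 <= a -> 0 <= b ->
  s * (b `^ (s - 1) * a) <= (s - 1) * b `^ s + a `^ s.
Proof.
move=> s1 a0 b0; have s0 : 0 < s by lra.
move: s1; rewrite le_eqVlt => /predU1P[<-|s1].
  by rewrite subrr powRr0 !powRr1// mul0r add0r !mul1r.
have sB0 : 0 < s - 1 by lra.
have := @conjugate_powR R a (b `^ (s - 1)) s (s / (s - 1)) a0 (powR_ge0 _ _) s0.
rewrite divr_gt0// invf_div -{1}[s^-1]div1r -mulrDl addrC subrK divff ?gt_eqF//.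
move=> /(_ isT erefl); rewrite -powRrM [(s - 1) * _]mulrC divfK ?gt_eqF//.
move=> h.
have -> : (s - 1) * b `^ s + a `^ s =
  s * (a `^ s / s + b `^ s * ((s - 1) / s)) by field; rewrite gt_eqF.
by rewrite ler_pM2l// mulrC.
Qed.

(** Crude form of Young's inequality, without conjugate exponents: compare both
    factors with the larger of the two bases. *)
Lemma powR_mix s x t z : 0 <= s -> 0 <= x -> 0 <= t -> 0 < z ->
  s `^ t * x `^ z <= s `^ (t + z) + x `^ (t + z).
Proof.
move=> s0 x0 t0 z0.
have tz : t + z != 0 by rewrite gt_eqF//; lra.
have D c : c `^ (t + z) = c `^ t * c `^ z by rewrite powRD// (negbTE tz).
have [sx|xs] := leP s x.
  rewrite -[leLHS]add0r lerD ?powR_ge0// D ler_wpM2r ?powR_ge0//.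
  by rewrite ge0_ler_powR// nnegrE.
rewrite -[leLHS]addr0 lerD ?powR_ge0// D ler_wpM2l ?powR_ge0//.
by rewrite ge0_ler_powR ?nnegrE// ltW.
Qed.

(** The signed power sgn(x)|x|^t: for t = r - 1 it is, up to the factor r, the
    derivative of |x|^r, and for t = 0 it is the sign. *)
Definition spow t x : R := x * `|x| `^ (t - 1).

Lemma norm_spow t x : 0 < t -> `|spow t x| = `|x| `^ t.
Proof. by move=> t0; rewrite normrM (ger0_norm (powR_ge0 _ _)) mulr_powRB1. Qed.

Lemma spow_mul_self r x : 1 < r -> spow (r - 1) x * x = `|x| `^ r.
Proof.
move=> r1; have r0 : 0 < r by lra.
have xx : x * x = `|x| * `|x| by rewrite -normrM ger0_norm// -expr2 sqr_ge0.
rewrite /spow mulrAC xx -mulrA mulr_powRB1//; last lra.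
by rewrite mulr_powRB1.
Qed.

(** Convexity of |x|^r with the tangent taken at the endpoint b: evaluating the
    derivative at the later time and then moving it back by [spow_lip] avoids
    second derivatives altogether. *)
Lemma powR_convex r a b : 1 < r ->
  `|b| `^ r - `|a| `^ r <= r * (spow (r - 1) b * (b - a)).
Proof.
move=> r1; have r0 : 0 < r by lra.
have := powR_tangent (ltW r1) (normr_ge0 a) (normr_ge0 b).
have Ha : spow (r - 1) b * a <= `|b| `^ (r - 1) * `|a|.
  rewrite -norm_spow; last lra.
  by rewrite -normrM ler_norm.
rewrite mulrBr spow_mul_self// => h.
suff : r * (spow (r - 1) b * a) <= r * (`|b| `^ (r - 1) * `|a|) by lra.
by rewrite ler_pM2l.
Qed.

Lemma spowN t x : spow t (- x) = - spow t x.
Proof. by rewrite /spow normrN mulNr. Qed.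

(** By symmetry and oddness one may assume |a| <= b; the signed power is then
    convex between a and b if a >= 0, and otherwise both values are estimated
    separately, the distance b - a being |a| + |b|. *)
Lemma spow_lip t s a b : 1 <= t -> `|a| <= s -> `|b| <= s ->
  `|spow t b - spow t a| <= t * (s `^ (t - 1) * `|b - a|).
Proof.
move=> t1; wlog : a b / `|a| <= `|b|.
  move=> H ha hb; have [ab|/ltW ba] := leP `|a| `|b|; first exact: H.
  by rewrite distrC [ `|b - a| ]distrC; apply: H.
wlog b0 : a b / 0 <= b.
  move=> H ab ha hb; have [b0|/ltW b0] := leP 0 b; first exact: H.
  have := H (- a) (- b); rewrite !normrN oppr_ge0 !spowN.
  rewrite -(normrN (- spow _ _ - _)) -(normrN (- b - _)) !opprB !opprK.
  rewrite -!(addrC (- _)) !(addrC (- _)) => H'; exact: H'.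
rewrite (ger0_norm b0) => ab ha hb.
have t0 : 0 < t by lra.
have s0 : 0 <= s by apply: le_trans ha.
have ab' : a <= b by apply: le_trans ab; exact: ler_norm.
have Eb : spow t b = b `^ t by rewrite /spow ger0_norm// mulr_powRB1.
have bs : b `^ (t - 1) <= s `^ (t - 1).
  by rewrite ge0_ler_powR ?nnegrE ?subr_ge0.
apply: (@le_trans _ _ (t * (b `^ (t - 1) * `|b - a|))); last first.
  by rewrite ler_pM2l// ler_wpM2r.
rewrite [ `|b - a| ]ger0_norm ?subr_ge0//.
have [a0|a0] := leP 0 a.
  have Ea : spow t a = a `^ t by rewrite /spow ger0_norm// mulr_powRB1.
  rewrite Ea Eb ger0_norm; last by rewrite subr_ge0 ge0_ler_powR// ltW.
  have := powR_tangent t1 a0 b0.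
  rewrite mulrBr -[_ * b]mulrC mulr_powRB1//; lra.
rewrite ltr0_norm// in ab.
rewrite (le_trans (ler_normB _ _))// !norm_spow// ger0_norm// ltr0_norm//.
rewrite -(mulr_powRB1 b0 t0) -(@mulr_powRB1 _ (- a))//; last lra.
have h1 : (- a) `^ (t - 1) <= b `^ (t - 1).
  by rewrite ge0_ler_powR ?nnegrE ?subr_ge0 ?oppr_ge0// ltW.
have h2 := powR_ge0 b (t - 1).
have h3 : 0 <= (t - 1) * (b `^ (t - 1) * (b - a)).
  by rewrite !mulr_ge0//; lra.
have h4 : - a * (- a) `^ (t - 1) <= - a * b `^ (t - 1).
  by rewrite ler_wpM2l//; lra.
lra.
Qed.

End powers.

(** * Pathwise inequalities *)

Section running_max.
Context {R : realType}.
Implicit Types (u m : nat -> R) (c : R).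

Fixpoint runmax u n : R :=
  if n is k.+1 then Num.max (runmax u k) (u n) else u 0%N.

Lemma runmax_le u n c : (forall k, (k <= n)%N -> u k <= c) -> runmax u n <= c.
Proof.
elim: n => [|n IH] h /=; first exact: h.
by rewrite ge_max h// andbT IH// => k kn; apply: h; exact: leqW.
Qed.

Lemma le_runmax u n k : (k <= n)%N -> u k <= runmax u n.
Proof.
elim: n k => [|n IH] k /=; first by rewrite leqn0 => /eqP ->.
rewrite leq_eqVlt => /predU1P[->|kn]; first by rewrite le_max lexx orbT.
by rewrite le_max IH.
Qed.

Lemma runmax_ge0 u n : (forall k, 0 <= u k) -> 0 <= runmax u n.
Proof. by move=> u0; exact: le_trans (le_runmax _ (leq0n n)). Qed.

Lemma runmax_nd u : nondecreasing_seq (runmax u).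
Proof. by apply/nondecreasing_seqP => n /=; rewrite le_max lexx. Qed.

Definition transform (g m : nat -> R) n : R :=
  \sum_(k < n) g k * (m k.+1 - m k).

Lemma transformZD (a b : R) (g h m : nat -> R) n :
  transform (fun k => a * g k + b * h k) m n =
  a * transform g m n + b * transform h m n.
Proof.
rewrite /transform !mulr_sumr -big_split/=; apply: eq_bigr => k _; ring.
Qed.

(** Pathwise version of Doob's L^r inequality, by induction on N.  Only the
    steps at which the maximum increases matter, and there the maximum and
    |m| coincide, so that the increment is controlled by [powR_tangent]. *)
Lemma pathwise_doob (r : R) (m : nat -> R) N : 1 < r ->
  (r - 1) * runmax (fun k => `|m k|) N `^ r <=
    r * (runmax (fun k => `|m k|) N `^ (r - 1) * `|m N|) -
    r * transform
      (fun k => runmax (fun j => `|m j|) k `^ (r - 1) * Num.sg (m k)) m N.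
Proof.
move=> r1; have r0 : 0 < r by lra.
set s := runmax (fun k => `|m k|).
have s0 k : 0 <= s k by exact: runmax_ge0.
have pw (x : R) : 0 <= x -> x `^ (r - 1) * x = x `^ r.
  by move=> x0; rewrite mulrC mulr_powRB1.
elim: N => [|n IH].
  rewrite /transform big_ord0 mulr0 subr0 /s/= pw//.
  by have := powR_ge0 `|m 0%N| r; lra.
have -> : transform (fun k => s k `^ (r - 1) * Num.sg (m k)) m n.+1 =
    transform (fun k => s k `^ (r - 1) * Num.sg (m k)) m n +
    s n `^ (r - 1) * Num.sg (m n) * (m n.+1 - m n).
  by rewrite /transform big_ord_recr.
set G := transform _ _ _ in IH *.
set b : R := `|m n.+1|.
have key : r * (s n `^ (r - 1) * b) - (r - 1) * s n `^ r <=
    r * (s n.+1 `^ (r - 1) * b) - (r - 1) * s n.+1 `^ r.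
  have -> : s n.+1 = Num.max (s n) b by [].
  case: (leP (s n) b) => sb //.
  have := powR_tangent (ltW r1) (normr_ge0 _ : 0 <= b) (s0 n).
  rewrite pw; last exact: normr_ge0.
  lra.
have step : s n `^ (r - 1) * Num.sg (m n) * (m n.+1 - m n) <=
    s n `^ (r - 1) * b - s n `^ (r - 1) * `|m n|.
  rewrite -mulrA -mulrBr ler_wpM2l ?powR_ge0// mulrBr -normrEsg lerB//.
  rewrite (le_trans (ler_norm _))// normrM ler_piMl//.
  by rewrite normr_sg; case: eqP.
have : r * (s n `^ (r - 1) * Num.sg (m n) * (m n.+1 - m n)) <=
    r * (s n `^ (r - 1) * b - s n `^ (r - 1) * `|m n|) by rewrite ler_pM2l.
lra.
Qed.

Lemma telescope_sum (u : nat -> R) n :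
  \sum_(k < n) (u k.+1 - u k) = u n - u 0%N.
Proof.
by rewrite -(big_mkord xpredT (fun k => u k.+1 - u k)) telescope_sumr.
Qed.

(** Discrete Itô formula for |q|^r, in which the terms against the increments of
    h have been summed by parts. *)
Lemma pathwise_ito (r : R) (q h : nat -> R) N (S z y w : R) :
  2 <= r -> 0 <= y ->
  (forall k, (k <= N)%N -> `|q k| <= S) ->
  (forall k, (k <= N)%N -> `|h k| <= z) ->
  (forall k, (k < N)%N -> `|q k.+1 - q k| <= y) ->
  \sum_(k < N) `|q k.+1 - q k| <= w ->
  h 0%N + q 0%N = 0 ->
  `|q N| `^ r <= z `^ r + r * (S `^ (r - 1) * z) +
     r ^+ 2 * (S `^ (r - 2) * ((z + y) * w)) +
     r * transform (fun k => spow (r - 1) (q k)) (fun k => h k + q k) N.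
Proof.
move=> r2 y0 qS hz dqy dqw h0.
have r0 : 0 < r by lra.
have r1 : 1 < r by lra.
have S0 : 0 <= S := le_trans (normr_ge0 _) (qS 0%N (leq0n N)).
have z0 : 0 <= z := le_trans (normr_ge0 _) (hz 0%N (leq0n N)).
set f := fun k => `|q k| `^ r; set phi := fun k => spow (r - 1) (q k).
pose C := (r - 1) * (S `^ (r - 2) * (z + y)).
have phiS k : (k <= N)%N -> `|phi k| <= S `^ (r - 1).
  move=> kN; rewrite norm_spow; last lra.
  by rewrite ge0_ler_powR ?nnegrE ?subr_ge0 ?(ltW r1)// qS.
(* The three terms are the martingale increment, the telescoping part of the
   summation by parts, and the variation of phi against h + dq. *)
have step (k : 'I_N) : f k.+1 - f k <=
    r * (phi k * (h k.+1 + q k.+1 - (h k + q k))) -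
    r * (phi k.+1 * h k.+1 - phi k * h k) + r * (C * `|q k.+1 - q k|).
  have cvx := powR_convex (q k) (q k.+1) r1; rewrite -/(phi _) in cvx.
  have kN : (k < N)%N := ltn_ord k.
  have : (h k.+1 + (q k.+1 - q k)) * (phi k.+1 - phi k) <= C * `|q k.+1 - q k|.
    rewrite (le_trans (ler_norm _))// normrM.
    have -> : C * `|q k.+1 - q k| =
      (z + y) * ((r - 1) * (S `^ (r - 1 - 1) * `|q k.+1 - q k|)).
      by rewrite /C (_ : r - 1 - 1 = r - 2); ring.
    rewrite ler_pM//.
      by rewrite (le_trans (ler_normD _ _))// lerD ?hz ?dqy.
    by apply: spow_lip; rewrite ?qS// 1?ltnW//; lra.
  rewrite -(ler_pM2l r0) => le.
  rewrite -[f _]/(`|q k.+1| `^ r) -[f k]/(`|q k| `^ r).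
  lra.
have tot : f N - f 0%N <= r * transform phi (fun k => h k + q k) N
    - r * (phi N * h N - phi 0%N * h 0%N)
    + r * (C * \sum_(k < N) `|q k.+1 - q k|).
  rewrite -(telescope_sum f) -(telescope_sum (fun k => phi k * h k)).
  rewrite /transform !mulr_sumr -sumrB -big_split/=.
  by apply: ler_sum => k _; exact: step.
have f0z : f 0%N <= z `^ r.
  rewrite /f (_ : q 0%N = - h 0%N); last lra.
  by rewrite normrN ge0_ler_powR ?nnegrE ?(ltW r0)// hz.
have ph0 : phi 0%N * h 0%N <= 0.
  rewrite (_ : h 0%N = - q 0%N); last lra.
  by rewrite mulrN /phi spow_mul_self// oppr_le0 powR_ge0.
have phN : - (phi N * h N) <= S `^ (r - 1) * z.
  rewrite (le_trans (ler_norm _))// normrN normrM ler_pM// ?phiS// hz//.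
have Cw : C * \sum_(k < N) `|q k.+1 - q k| <=
    r * (S `^ (r - 2) * ((z + y) * w)).
  have w0 : 0 <= w by apply: le_trans dqw; exact: sumr_ge0.
  apply: (@le_trans _ _ (C * w)).
    apply: ler_wpM2l dqw; rewrite /C mulr_ge0 ?subr_ge0 ?(ltW r1)//.
    by rewrite mulr_ge0 ?powR_ge0// addr_ge0.
  rewrite /C -!mulrA ler_wpM2r//; last lra.
  by rewrite mulr_ge0 ?powR_ge0// mulr_ge0// addr_ge0.
have : r * (phi 0%N * h 0%N) <= 0 by rewrite pmulr_rle0.
move: phN; rewrite -(ler_pM2l r0) => phN.
move: Cw; rewrite -(ler_pM2l r0) => Cw.
rewrite -[ `|q N| `^ r]/(f N) expr2; lra.
Qed.

Lemma powR_ratio_le (r : R) : 1 < r -> (r / (r - 1)) `^ (r - 1) <= expR 1.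
Proof.
move=> r1; have rB : 0 < r - 1 by lra.
have -> : r / (r - 1) = 1 + (r - 1)^-1 by field; rewrite gt_eqF.
apply: (@le_trans _ _ (expR (r - 1)^-1 `^ (r - 1))).
  rewrite ge0_ler_powR ?nnegrE ?expR_ge0 ?(ltW rB)//.
    by rewrite addr_ge0// invr_ge0 ltW.
  exact: expR_ge1Dx.
by rewrite -expRM mulVf ?gt_eqF.
Qed.

(** Splitting s + z at the threshold z = s/r costs only the factor
    (1 + 1/r)^r <= e in front of s^r, unlike the factor 2^(r-1) that convexity
    gives. *)
Lemma powR_add_le (r s z : R) : 1 <= r -> 0 <= s -> 0 <= z ->
  (s + z) `^ r <= expR 1 * s `^ r + (2 * r * z) `^ r.
Proof.
move=> r1 s0 z0; have r0 : 0 < r by lra.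
have [zs|sz] := leP (r * z) s.
  rewrite -[leLHS]addr0 lerD ?powR_ge0//.
  have -> : expR 1 * s `^ r = (expR r^-1 * s) `^ r.
    by rewrite powRM ?expR_ge0// -expRM mulVf ?gt_eqF.
  have zs' : z <= r^-1 * s by rewrite -(ler_pM2l r0) mulVKf ?gt_eqF.
  rewrite ge0_ler_powR ?nnegrE ?(ltW r0) ?addr_ge0 ?mulr_ge0 ?expR_ge0//.
  apply: (@le_trans _ _ ((1 + r^-1) * s)); first by rewrite mulrDl mul1r lerD.
  by rewrite ler_wpM2r// expR_ge1Dx.
rewrite -[leLHS]add0r lerD ?mulr_ge0 ?expR_ge0 ?powR_ge0//.
rewrite ge0_ler_powR ?nnegrE ?(ltW r0) ?addr_ge0 ?mulr_ge0 ?(ltW r0)//.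
have : z <= r * z by rewrite ler_peMl.
lra.
Qed.

(** The constant in front of |q_N|^r does not depend on r, which is what the
    final bound p^{4p} requires. *)
Lemma runmax_doob (r : R) (q h m : nat -> R) N (z : R) : 2 <= r ->
  (forall k, m k = h k + q k) -> (forall k, (k <= N)%N -> `|h k| <= z) ->
  runmax (fun k => `|m k|) N `^ r <=
    4 * expR 1 * `|q N| `^ r + (4 * r * z) `^ r
    - 4 * r * transform
       (fun k => runmax (fun j => `|m j|) k `^ (r - 1) * Num.sg (m k)) m N.
Proof.
set s := runmax (fun k => `|m k|).
move=> r2 mE hz; have r1 : 1 < r by lra.
have r0 : 0 < r by lra.
have s0 k : 0 <= s k by exact: runmax_ge0.
have z0 : 0 <= z := le_trans (normr_ge0 _) (hz 0%N (leq0n N)).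
have := pathwise_doob m N r1; rewrite -/s.
set G := transform _ _ _ => doob.
have mN : `|m N| <= `|q N| + z.
  by rewrite mE addrC (le_trans (ler_normD _ _))// lerD// hz.
have sm : s N `^ (r - 1) * `|m N| <= s N `^ (r - 1) * (`|q N| + z).
  by rewrite ler_wpM2l// powR_ge0.
have zpart : s N `^ (r - 1) * (4 * r * z) <= s N `^ r + (4 * r * z) `^ r.
  have rz : 0 <= 4 * r * z by rewrite !mulr_ge0 ?(ltW r0).
  have := @powR_mix _ (s N) (4 * r * z) (r - 1) 1 (s0 N) rz.
  by rewrite subrK powRr1//; apply=> //; lra.
(* Of the r - 1 copies of s^r on the left-hand side, this choice of the parameter
   in Young's inequality uses up (r - 1)^2 / r and leaves 1 - 1/r >= 1/2; the
   term with z takes another quarter. *)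
pose l := r / (r - 1); have rB : 0 < r - 1 by lra.
have l0 : 0 < l by rewrite divr_gt0.
have qpart : r * (s N `^ (r - 1) * `|q N|) <=
    (r - 1) ^+ 2 / r * s N `^ r + expR 1 * `|q N| `^ r.
  have lq : 0 <= l * `|q N| by rewrite mulr_ge0 ?(ltW l0).
  have := powR_tangent (ltW r1) lq (s0 N).
  rewrite powRM ?(ltW l0)// -[l `^ r](mulr_powRB1 (ltW l0) r0) => tg.
  rewrite -(ler_pM2l l0).
  have le1 : l * (l `^ (r - 1) * `|q N| `^ r) <= l * (expR 1 * `|q N| `^ r).
    rewrite ler_pM2l// ler_wpM2r ?powR_ge0//; exact: powR_ratio_le.
  have El : l * ((r - 1) ^+ 2 / r * s N `^ r) = (r - 1) * s N `^ r.
    by rewrite /l; field; rewrite !gt_eqF.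
  rewrite [leRHS]mulrDr El; lra.
have El2 : (r - 1) ^+ 2 / r = (r - 1) - (1 - r^-1) by field; rewrite gt_eqF.
have rV : r^-1 <= 2^-1 by rewrite lef_pV2 ?posrE.
have : r^-1 * s N `^ r <= 2^-1 * s N `^ r by rewrite ler_wpM2r ?powR_ge0.
move: sm; rewrite -(ler_pM2l r0) => sm.
rewrite El2 in qpart; lra.
Qed.

(** The integrand of the martingale transform in [pathwise_bound]: the first
    summand comes from Itô's formula and the second from Doob's inequality. *)
Definition weight (r : R) (q m : nat -> R) (k : nat) : R :=
  8 * expR 1 ^+ 2 * r * spow (r - 1) (q k)
  + - (8 * r * expR 1) * (runmax (fun j => `|m j|) k `^ (r - 1) * Num.sg (m k)).

Definition pathwise_const (r : R) : R :=
  2 * (4 * expR 1 ^+ 2 + expR 1 + 2) * (16 * expR 1 ^+ 2 * r) `^ r.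

Lemma pathwise_const_ge0 (r : R) : 0 <= pathwise_const r.
Proof.
have E0 : 0 <= expR 1 :> R by exact: expR_ge0.
by rewrite /pathwise_const !mulr_ge0 ?powR_ge0// !addr_ge0 ?mulr_ge0 ?exprn_ge0.
Qed.

(** Chains [powR_add_le], [runmax_doob] and [pathwise_ito], and absorbs the
    mixed terms into S^r by [powR_mix]. *)
Lemma pathwise_bound (p : R) (q h m : nat -> R) N (z y w : R) :
  1 < p -> 0 <= y ->
  (forall k, m k = h k + q k) ->
  (forall k, (k <= N)%N -> `|h k| <= z) ->
  (forall k, (k < N)%N -> `|q k.+1 - q k| <= y) ->
  \sum_(k < N) `|q k.+1 - q k| <= w ->
  m 0%N = 0 ->
  runmax (fun k => `|q k|) N `^ (2 * p) <=
    pathwise_const (2 * p) *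
      (z `^ (2 * p) + ((z + y) * w) `^ p)
    + transform (weight (2 * p) q m) m N.
Proof.
move=> p1 y0 mE hz dqy dqw m0.
rewrite /pathwise_const; set S := runmax _ _.
set r := 2 * p; set E := expR 1 : R.
have E1 : 1 <= E by rewrite /E; have := @expR_ge1Dx R 1; lra.
have r2 : 2 <= r by rewrite /r; lra.
have [r0 r1] : 0 < r /\ 1 < r by split; lra.
have p0 : 0 <= p by lra.
have z0 : 0 <= z := le_trans (normr_ge0 _) (hz 0%N (leq0n N)).
have w0 : 0 <= w by apply: le_trans dqw; exact: sumr_ge0.
have S0 : 0 <= S by exact: runmax_ge0.
have qS k : (k <= N)%N -> `|q k| <= S by exact: (le_runmax (fun k => `|q k|)).
have v0 : 0 <= (z + y) * w by rewrite mulr_ge0// addr_ge0.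
have E0 : 0 < E by lra.
have EE : 1 <= E ^+ 2 by rewrite expr2; have := ler_pM ler01 ler01 E1 E1; lra.
set v := (z + y) * w in v0 *.
rewrite /weight transformZD.
have hq0 : h 0%N + q 0%N = 0 by rewrite -mE.
have := pathwise_ito r2 y0 qS hz dqy dqw hq0.
have -> : (fun k => h k + q k) = m by apply/funext.
have := runmax_doob r2 mE hz; rewrite /=.
set s := runmax _ N; set G1 := transform _ m N; set G2 := transform _ m N.
rewrite -/v => doob ito.
have s0 : 0 <= s by exact: runmax_ge0.
have Ssz : S <= s + z.
  apply: runmax_le => k kN; have -> : q k = m k - h k by rewrite mE; ring.
  rewrite (le_trans (ler_normB _ _))// lerD ?hz//.
  exact: (le_runmax (fun k => `|m k|)).
have Ss : S `^ r <= E * s `^ r + (2 * r * z) `^ r.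
  apply: le_trans (powR_add_le (ltW r1) s0 z0).
  by rewrite ge0_ler_powR ?nnegrE ?(ltW r0)// addr_ge0.
(* L is four times the coefficient 4 E^2 r of S^(r-1) z, so that each of the two
   mixed terms takes up only a quarter of S^r. *)
pose L := 16 * E ^+ 2 * r.
have L0 : 0 <= L by rewrite /L mulr_ge0 ?(ltW r0)//; lra.
have Lr : 0 <= r * E ^+ 2 - r.
  by rewrite -[X in _ - X]mulr1 -mulrBr mulr_ge0 ?subr_ge0 ?(ltW r0).
have LE : L = 16 * (r * E ^+ 2) by rewrite /L; ring.
have zL c : 0 <= c -> c <= L -> (c * z) `^ r <= L `^ r * z `^ r.
  move=> c0 cL; rewrite -powRM// ge0_ler_powR ?nnegrE ?(ltW r0)//.
  - exact: mulr_ge0.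
  - exact: mulr_ge0.
  - exact: ler_wpM2r.
have L1 : 1 <= L `^ r.
  have <- : 1 `^ r = 1 :> R by rewrite powR1.
  by rewrite ge0_ler_powR ?nnegrE ?(ltW r0)//; lra.
have h1 : S `^ (r - 1) * (L * z) <= S `^ r + (L * z) `^ r.
  have Lz : 0 <= L * z by rewrite mulr_ge0.
  have := @powR_mix _ S (L * z) (r - 1) 1 S0 Lz.
  by rewrite subrK powRr1//; apply=> //; lra.
have h2 : S `^ (r - 2) * (L * r * v) <= S `^ r + L `^ r * v `^ p.
  have Lrv : 0 <= L * r * v by rewrite mulr_ge0// mulr_ge0// ltW.
  have := @powR_mix _ S ((L * r * v) `^ (2^-1)) (r - 2) 2 S0 (powR_ge0 _ _).
  rewrite subrK -!powRrM mulVf// powRr1// (_ : 2^-1 * r = p); last first.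
    by rewrite /r; field.
  have le2 : (L * r * v) `^ p <= L `^ r * v `^ p.
    have Lr0 : 0 <= L * r by rewrite mulr_ge0// ltW.
    rewrite (powRM _ Lr0 v0) ler_wpM2r ?powR_ge0//.
    have -> : L `^ r = (L * L) `^ p by rewrite -expr2 -powR_mulrn// -powRrM.
    have rL : L * r <= L * L by rewrite ler_wpM2l//; clear -LE Lr r0; lra.
    by rewrite ge0_ler_powR ?nnegrE// mulr_ge0.
  move=> h2; apply: le_trans (h2 _ _) _ => //; first by lra.
  by rewrite lerD2l.
have a1 := zL L L0 (lexx _).
have a2 : (4 * r * z) `^ r <= L `^ r * z `^ r.
  by apply: zL; clear -LE Lr r0; lra.
have a3 : (2 * r * z) `^ r <= L `^ r * z `^ r.
  by apply: zL; clear -LE Lr r0; lra.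
have a4 : z `^ r <= L `^ r * z `^ r by rewrite ler_peMl// powR_ge0.
have b1 : E * (4 * r * z) `^ r <= E * (L `^ r * z `^ r) by rewrite ler_pM2l.
have E4 : 0 < 4 * E ^+ 2 by rewrite mulr_gt0// exprn_gt0.
have b2 : 4 * E ^+ 2 * z `^ r <= 4 * E ^+ 2 * (L `^ r * z `^ r).
  by rewrite ler_pM2l.
have b3 : 0 <= (4 * E ^+ 2 + E + 1) * (L `^ r * v `^ p).
  by rewrite !mulr_ge0 ?powR_ge0//; clear -E0 EE; lra.
move: doob; rewrite -(ler_pM2l E0) => doob.
move: ito; rewrite -(ler_pM2l E4) => ito.
have e1 : 4 * E ^+ 2 * (r * (S `^ (r - 1) * z)) =
    4^-1 * (S `^ (r - 1) * (L * z)).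
  by rewrite /L; field.
have e2 : 4 * E ^+ 2 * (r ^+ 2 * (S `^ (r - 2) * v)) =
    4^-1 * (S `^ (r - 2) * (L * r * v)) by rewrite /L; field.
rewrite -[16 * _ * r]/L -[expR 1]/E.
have c1 : 0 <= L `^ r * z `^ r by rewrite mulr_ge0 ?powR_ge0.
have c2 : 0 <= L `^ r * v `^ p by rewrite mulr_ge0 ?powR_ge0.
rewrite !mulrDr e1 e2 in ito.
rewrite -[expR 1]/E !mulrDr in doob.
clear -Ss doob ito h1 h2 a1 a2 a3 b1 b2 b3 c1 c2.
lra.
Qed.

End running_max.

Section path_estimates.
Context {R : realType}.

Lemma powRD_le (p a b : R) : 0 <= p -> 0 <= a -> 0 <= b ->
  (a + b) `^ p <= 2 `^ p * (a `^ p + b `^ p).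
Proof.
move=> p0; wlog ab : a b / a <= b.
  move=> H a0 b0; have [ab|/ltW ba] := leP a b; first exact: H.
  by rewrite addrC [a `^ p + _]addrC; exact: H.
move=> a0 b0; apply: (@le_trans _ _ ((2 * b) `^ p)).
  by rewrite ge0_ler_powR ?nnegrE ?addr_ge0 ?mulr_ge0//; lra.
by rewrite powRM// ler_wpM2l ?powR_ge0// lerDr powR_ge0.
Qed.

(** From K <= p^2 e^(K/p^2): a fixed geometric growth in p is absorbed by
    p^{2p}, uniformly in p >= 1. *)
Lemma powR_le_expR (K p : R) : 0 < K -> 1 <= p ->
  K `^ p <= expR K * p `^ (2 * p).
Proof.
move=> K0 p1; have p0 : 0 < p by lra.
have p20 : 0 < p ^+ 2 by rewrite exprn_gt0.
have le1 : K <= p ^+ 2 * expR (K / p ^+ 2).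
  have := @expR_ge1Dx R (K / p ^+ 2).
  rewrite -(ler_pM2l p20) mulrDr mulr1 mulrCA divff ?gt_eqF// mulr1; lra.
apply: (@le_trans _ _ ((p ^+ 2 * expR (K / p ^+ 2)) `^ p)).
  rewrite ge0_ler_powR ?nnegrE ?(ltW p0) ?(ltW K0)//.
  by rewrite mulr_ge0 ?expR_ge0 ?(ltW p20).
rewrite powRM ?expR_ge0 ?(ltW p20)// mulrC powRrM powR_mulrn ?(ltW p0)//.
rewrite ler_wpM2r ?powR_ge0// -expRM ler_expR.
have -> : K / p ^+ 2 * p = K / p by field; rewrite gt_eqF.
by rewrite ler_pdivrMr// ler_peMr// ltW.
Qed.

Lemma total_variation_le (a b : nat -> R) N :
  (forall n, 0 <= a n /\ 0 <= b n) ->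
  (forall n, a n <= a n.+1 /\ b n <= b n.+1) ->
  \sum_(k < N) `|(a k.+1 - b k.+1) - (a k - b k)| <= a N + b N.
Proof.
move=> ge0 nd.
apply: (@le_trans _ _ (\sum_(k < N) (a k.+1 + b k.+1 - (a k + b k)))).
  apply: ler_sum => k _; have [h1 h2] := nd k.
  rewrite (_ : _ - _ - _ = (a k.+1 - a k) - (b k.+1 - b k)); last by ring.
  rewrite (le_trans (ler_normB _ _))// !ger0_norm ?subr_ge0//; lra.
rewrite (telescope_sum (fun k => a k + b k)).
by have [] := ge0 0%N; lra.
Qed.

Definition moment_const (p : R) : R := pathwise_const (2 * p) * 2 `^ p.

(** Gives the integrability of the summands of the martingale transform, which
    are of the same order r as the moments assumed finite. *)
Lemma weight_le (r b : R) (q m : nat -> R) k : 1 < r ->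
  (forall j, (j <= k)%N -> `|q j| <= b) ->
  (forall j, (j <= k.+1)%N -> `|m j| <= b) ->
  `|weight r q m k * (m k.+1 - m k)| <=
    2 * (8 * expR 1 ^+ 2 * r + 8 * r * expR 1) * b `^ r.
Proof.
move=> r1 qb mb; have r0 : 0 < r by lra.
have b0 : 0 <= b := le_trans (normr_ge0 _) (qb 0%N (leq0n _)).
have E0 : 0 <= expR 1 :> R by exact: expR_ge0.
have c1 : 0 <= 8 * expR 1 ^+ 2 * r by rewrite !mulr_ge0 ?exprn_ge0 ?(ltW r0).
have c2 : 0 <= 8 * r * expR 1 by rewrite !mulr_ge0 ?(ltW r0).
rewrite normrM -(mulr_powRB1 b0 r0).
have -> : 2 * (8 * expR 1 ^+ 2 * r + 8 * r * expR 1) * (b * b `^ (r - 1)) =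
    (8 * expR 1 ^+ 2 * r * b `^ (r - 1) + 8 * r * expR 1 * b `^ (r - 1)) *
    (b + b) by ring.
rewrite ler_pM//; last by rewrite (le_trans (ler_normB _ _))// lerD// mb.
rewrite (le_trans (ler_normD _ _))// lerD//.
  rewrite normrM (ger0_norm c1) ler_wpM2l// norm_spow; last lra.
  by rewrite ge0_ler_powR ?nnegrE ?qb//; lra.
rewrite normrM normrN (ger0_norm c2) ler_wpM2l//.
rewrite normrM (ger0_norm (powR_ge0 _ _)).
apply: (@le_trans _ _ (runmax (fun j => `|m j|) k `^ (r - 1) * 1)).
  by rewrite ler_wpM2l ?powR_ge0// normr_sg; case: eqP.
rewrite mulr1 ge0_ler_powR ?nnegrE ?runmax_ge0//; first lra.
by apply: runmax_le => j jk; apply: mb; exact: leqW.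
Qed.

Lemma moment_const_le (p : R) : 1 < p ->
  moment_const p <= 2 * (4 * expR 1 ^+ 2 + expR 1 + 2) *
    expR (2 * (32 * expR 1 ^+ 2) ^+ 2) * p `^ (4 * p).
Proof.
move=> p1; have p0 : 0 < p by lra.
have E0 : 0 < expR 1 :> R by exact: expR_gt0.
set E := expR 1 in E0 *; set D := 32 * E ^+ 2.
have D0 : 0 < D by rewrite mulr_gt0// exprn_gt0.
have K0 : 0 < 2 * D ^+ 2 by rewrite mulr_gt0// exprn_gt0.
rewrite /moment_const /pathwise_const -/E -[leLHS]mulrA -[leRHS]mulrA.
rewrite ler_wpM2l//.
  by rewrite mulr_ge0// !addr_ge0 ?mulr_ge0 ?exprn_ge0 ?(ltW E0).
have -> : 16 * E ^+ 2 * (2 * p) = D * p by rewrite /D; ring.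
rewrite powRM ?(ltW D0) ?(ltW p0)//.
have -> : D `^ (2 * p) * p `^ (2 * p) * 2 `^ p =
    (2 * D ^+ 2) `^ p * p `^ (2 * p).
  rewrite powRM ?exprn_ge0 ?(ltW D0)//.
  by rewrite [D `^ _]powRrM powR_mulrn ?(ltW D0)//; ring.
have -> : p `^ (4 * p) = p `^ (2 * p) * p `^ (2 * p).
  rewrite -powRD; first by congr powR; ring.
  by rewrite (gt_eqF p0) implybT.
by rewrite mulrA ler_wpM2r ?powR_ge0// powR_le_expR// ltW.
Qed.

End path_estimates.

(** * Martingale transforms have zero expectation *)

Section conditional.
Import HBNNSimple.
Context d (T : measurableType d) (R : realType) (P : probability T R).
Implicit Types (G : set (set T)) (f g X Y D : T -> R).

Lemma measurable_integrable_EFin D :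
  P.-integrable [set: T] (EFin \o D) -> measurable_fun [set: T] D.
Proof. by move=> iD; apply/measurable_EFinP; exact: measurable_int iD. Qed.

Lemma measurable_wrt_measurable G f : sigma_algebra [set: T] G ->
  G `<=` measurable -> measurable_wrt G f -> measurable_fun [set: T] f.
Proof.
move=> sG Gm mf mT B mB; apply: Gm.
by rewrite -(measurable_g_measurableTypeE sG); exact: mf.
Qed.

Lemma measurable_wrt_sub G1 G2 f : sigma_algebra [set: T] G1 ->
  sigma_algebra [set: T] G2 -> G1 `<=` G2 ->
  measurable_wrt G1 f -> measurable_wrt G2 f.
Proof.
move=> s1 s2 G12 mf mT B mB.
suff : G2 ([set: T] `&` f @^-1` B).
  by rewrite -[X in X _](measurable_g_measurableTypeE s2).
by apply: G12; rewrite -(measurable_g_measurableTypeE s1); exact: mf.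
Qed.

Lemma finite_range_expand (h : T -> R) x : finite_set (range h) ->
  h x = \sum_(y <- fset_set (range h)) y * \1_(h @^-1` [set y]) x.
Proof.
move=> fh; rewrite (bigD1_seq (h x))/= ?fset_uniq//; last first.
  by rewrite in_fset_set//; apply/mem_set; exists x.
rewrite indicE mem_set// mulr1 big1 ?addr0// => y yh.
by rewrite indicE memNset ?mulr0// => /esym/eqP; rewrite (negbTE yh).
Qed.

Lemma integral_simple_orth G (h D : T -> R) :
  sigma_algebra [set: T] G -> G `<=` measurable ->
  measurable_wrt G h -> finite_set (range h) ->
  P.-integrable [set: T] (EFin \o D) ->
  (forall A, G A -> (\int[P]_(x in A) (D x)%:E = 0)%E) ->
  (\int[P]_x (h x * D x)%:E = 0)%E.
Proof.
move=> sG Gm mhG fh iD D0.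
have mD := measurable_integrable_EFin iD.
have Gh y : G (h @^-1` [set y]).
  rewrite -[X in X _](measurable_g_measurableTypeE sG) -[X in _ X]setTI.
  exact: mhG.
have mh y : measurable (h @^-1` [set y] : set T) by apply: Gm.
pose s := fset_set (range h).
have hE x : h x * D x = \sum_(y <- s) y * (\1_(h @^-1` [set y]) x * D x).
  rewrite {1}(finite_range_expand x fh) mulr_suml.
  by apply: eq_bigr => y _; rewrite mulrA.
have i1 y : P.-integrable [set: T] (fun x => (\1_(h @^-1` [set y]) x * D x)%:E).
  apply: le_integrable iD => //.
    apply/measurable_EFinP; apply: measurable_funM.
      exact: measurable_indic.
    exact: mD.
  move=> x _ /=; rewrite lee_fin normrM ler_piMl// indicE.
  by case: (_ \in _); rewrite ?normr1 ?normr0.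
under eq_integral do rewrite hE -sumEFin.
rewrite integral_sum//; last first.
  by move=> y; under eq_fun do rewrite EFinM; exact: integrableZl.
rewrite big1// => y _.
under eq_integral do rewrite EFinM.
rewrite integralZl//.
rewrite (_ : \int[P]_x _ = \int[P]_(x in h @^-1` [set y]) (D x)%:E)%E.
  by rewrite D0// mule0.
rewrite [RHS]integral_mkcond; apply: eq_integral => x _.
rewrite patchE indicE.
by case: ifPn => _; rewrite ?mul1r ?mul0r.
Qed.

(** Approximation by simple functions from below and dominated convergence; the
    approximating functions are measurable with respect to G because the
    approximation is carried out on the space endowed with G. *)
Lemma integral_orth_ge0 G g D :
  sigma_algebra [set: T] G -> G `<=` measurable ->
  measurable_wrt G g -> (forall x, 0 <= g x) ->
  P.-integrable [set: T] (EFin \o D) ->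
  P.-integrable [set: T] (fun x => (g x * D x)%:E) ->
  (forall A, G A -> (\int[P]_(x in A) (D x)%:E = 0)%E) ->
  (\int[P]_x (g x * D x)%:E = 0)%E.
Proof.
move=> sG Gm mg g0 iD igD D0.
have mg' : measurable_fun [set: g_sigma_algebraType G]
  (fun x : g_sigma_algebraType G => (g x)%:E) by apply/measurable_EFinP.
pose h n : T -> R :=
  fun x : g_sigma_algebraType G => nnsfun_approx measurableT mg' n x.
have mhG n : measurable_wrt G (h n).
  by rewrite /measurable_wrt /h; exact: measurable_funP.
have mh n := measurable_wrt_measurable sG Gm (mhG n).
have mD := measurable_integrable_EFin iD.
have g0' (x : g_sigma_algebraType G) :
    [set: g_sigma_algebraType G] x -> (0 <= (g x)%:E)%E.
  by move=> _; rewrite lee_fin.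
have hg x : (h n x)%:E @[n --> \oo] --> (g x)%:E.
  exact: (cvg_nnsfun_approx measurableT mg' g0' (x := x)).
have hle n x : `|h n x| <= g x.
  rewrite ger0_norm; last exact: fun_ge0.
  rewrite /h nnsfun_approxE -lee_fin.
  exact: (le_approx n g0' (x := x)).
have fh n : finite_set (range (h n)).
  exact: (@fimfunP _ _ (nnsfun_approx measurableT mg' n)).
have hD0 n := integral_simple_orth sG Gm (mhG n) (fh n) iD D0.
have iN : P.-integrable [set: T] (fun x => `|(g x * D x)%:E|)%E.
  exact: integrable_abse.
have mhD n : measurable_fun [set: T] (fun x => (h n x * D x)%:E).
  by apply/measurable_EFinP; exact: measurable_funM.
have mgD := measurable_int _ igD.
have [||_ _] := @dominated_convergence _ _ _ P _ measurableT
   (fun n x => (h n x * D x)%:E) _ _ mhD mgD _ iN.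
- apply: aeW => x _.
  have Df : (D x)%:E \is a fin_num by [].
  have := cvgeZr Df (hg x).
  by rewrite -EFinM; under eq_cvg do rewrite -EFinM.
- apply: aeW => x n _.
  by rewrite /= lee_fin !normrM ler_wpM2r// (le_trans (hle n x))// ler_norm.
have -> : [sequence (\int[P]_x (h n x * D x)%:E)%E]_n = fun=> 0%E.
  by apply/funext => n; exact: hD0.
by move=> /cvg_lim <-//; rewrite lim_cst.
Qed.

Lemma integral_orth G g D :
  sigma_algebra [set: T] G -> G `<=` measurable ->
  measurable_wrt G g ->
  P.-integrable [set: T] (EFin \o D) ->
  P.-integrable [set: T] (fun x => (g x * D x)%:E) ->
  (forall A, G A -> (\int[P]_(x in A) (D x)%:E = 0)%E) ->
  (\int[P]_x (g x * D x)%:E = 0)%E.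
Proof.
move=> sG Gm mg iD igD D0.
have mgT := measurable_wrt_measurable sG Gm mg.
have mD := measurable_integrable_EFin iD.
have part (f : T -> R) : measurable_wrt G f -> (forall x, 0 <= f x) ->
    (forall x, f x <= `|g x|) ->
    P.-integrable [set: T] (fun x => (f x * D x)%:E) /\
    (\int[P]_x (f x * D x)%:E = 0)%E.
  move=> mf f0 fg.
  have ifD : P.-integrable [set: T] (fun x => (f x * D x)%:E).
    apply: le_integrable igD => //.
      apply/measurable_EFinP; apply: measurable_funM => //.
      exact: measurable_wrt_measurable mf.
    by move=> x _ /=; rewrite lee_fin !normrM ler_wpM2r// ger0_norm.
  by split=> //; exact: (integral_orth_ge0 sG Gm).
have [|x|x|i1 e1] := part (fun x => Num.max (g x) 0).
- rewrite /measurable_wrt; apply: measurable_maxr => //; exact: measurable_cst.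
- by rewrite le_max lexx orbT.
- by rewrite ge_max ler_norm normr_ge0.
have [|x|x|i2 e2] := part (fun x => Num.max (- g x) 0).
- rewrite /measurable_wrt; apply: measurable_maxr; last exact: measurable_cst.
  exact: measurableT_comp.
- by rewrite le_max lexx orbT.
- by rewrite ge_max normr_ge0 -normrN ler_norm.
transitivity (\int[P]_x ((Num.max (g x) 0 * D x)%:E -
                         (Num.max (- g x) 0 * D x)%:E))%E.
  apply: eq_integral => x _; rewrite -EFinB -mulrBl; congr (_ * _)%:E.
  case: (leP 0 (g x)) => gx.
    by rewrite [Num.max (- _) _]max_r ?oppr_le0// subr0.
  by rewrite [Num.max (- _) _]max_l ?oppr_ge0 ?(ltW gx)// opprK add0r.
by rewrite (integralB _ i1 i2)// e1 e2 sube0.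
Qed.

(** Each integrand is known at the beginning of its step and is therefore
    orthogonal to the martingale increment. *)
Lemma integral_transform F (M : nat -> T -> R) (g : nat -> T -> R) N :
  filtration F -> martingale P F M ->
  (forall k, measurable_wrt (F k) (g k)) ->
  (forall k, (k < N)%N ->
    P.-integrable [set: T] (fun x => (g k x * (M k.+1 x - M k x))%:E)) ->
  P.-integrable [set: T]
    (fun x => (transform (g ^~ x) (M ^~ x) N)%:E) /\
  (\int[P]_x (transform (g ^~ x) (M ^~ x) N)%:E = 0)%E.
Proof.
move=> [sF Fm _] [aM iM ceM] ag ig.
have zero k : (k < N)%N -> (\int[P]_x (g k x * (M k.+1 x - M k x))%:E = 0)%E.
  move=> kN; apply: (@integral_orth (F k)) => //.
  - rewrite (_ : EFin \o _ = (EFin \o M k.+1) \- (EFin \o M k))%E; last first.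
      by apply/funext => x /=; rewrite EFinB.
    exact: integrableB.
  - exact: ig.
  - move=> A FA; have [_ _ ce] := ceM k.
    have mA : measurable A by exact: (Fm k).
    have iA j : P.-integrable A (EFin \o M j) by apply: integrableS (iM j).
    under eq_integral do rewrite EFinB.
    rewrite integralB_EFin// ce// subee//.
    exact: integrable_fin_num (iA _).
have tE : (fun x => (transform (g ^~ x) (M ^~ x) N)%:E) =
  (fun x => \sum_(k < N) (g k x * (M k.+1 x - M k x))%:E)%E.
  by apply/funext => x; rewrite /transform -sumEFin.
rewrite tE; split.
  by apply: integrable_sum => // k _; exact: ig.
have := @integral_sum _ T R P setT measurableT 'I_N
  (fun k x => (g k x * (M k.+1 x - M k x))%:E) (fun k => ig k (ltn_ord k)).
move=> ->.
by rewrite big1// => k _; exact: zero.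
Qed.

Lemma cauchy_schwarz_powR (a b : T -> R) (p : R) : 0 < p ->
  measurable_fun [set: T] a -> measurable_fun [set: T] b ->
  (forall x, 0 <= a x) -> (forall x, 0 <= b x) ->
  (\int[P]_x ((a x * b x) `^ p)%:E <=
    (\int[P]_x (a x `^ (2 * p))%:E) `^ (2^-1) *
    (\int[P]_x (b x `^ (2 * p))%:E) `^ (2^-1))%E.
Proof.
move=> p0 ma mb a0 b0.
have mp (f : T -> R) : measurable_fun [set: T] f ->
    measurable_fun [set: T] (fun x => f x `^ p).
  by move=> mf; exact: (measurableT_comp (measurable_powR _)).
have h2 : (2^-1 + 2^-1 = 1 :> R)%R by field.
have := @hoelder _ _ _ P _ _ 2 2 (mp _ ma) (mp _ mb)
  (ltr0Sn _ 1) (ltr0Sn _ 1) h2.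
rewrite Lnorm1 unlock /=.
have E (f : T -> R) : (forall x, 0 <= f x) ->
   (\int[P]_x (`|f x `^ p| `^ 2)%:E = \int[P]_x (f x `^ (2 * p))%:E)%E.
  move=> f0; apply: eq_integral => x _.
  by rewrite ger0_norm ?powR_ge0// -powRrM mulrC.
rewrite !E//.
rewrite (_ : \int[P]_x _ = \int[P]_x ((a x * b x) `^ p)%:E)%E//.
apply: eq_integral => x _ /=.
by rewrite ger0_norm ?mulr_ge0 ?powR_ge0// powRM.
Qed.

End conditional.

(** * Measurability *)

Section meas.
Context d (T : measurableType d) (R : realType).

(** Reduces the measurability of the sign to that of signed powers. *)
Lemma sgE_spow (x : R) : Num.sg x = spow 0 x.
Proof.
rewrite /spow sub0r powR_inv1//.
have [->|x0] := eqVneq x 0; first by rewrite sgr0 mul0r.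
by rewrite {2}[x]numEsg mulfK// normr_eq0.
Qed.

Lemma measurable_spow (t : R) (f : T -> R) : measurable_fun [set: T] f ->
  measurable_fun [set: T] (fun x => spow t (f x)).
Proof.
move=> mf; apply: measurable_funM => //.
apply: (measurableT_comp (measurable_powR _)).
exact: measurableT_comp.
Qed.

Lemma measurable_runmax (u : nat -> T -> R) n :
  (forall k, (k <= n)%N -> measurable_fun [set: T] (u k)) ->
  measurable_fun [set: T] (fun x => runmax (u ^~ x) n).
Proof.
elim: n => [|n IH] mu /=; first exact: mu.
apply: measurable_maxr; last exact: mu.
by apply: IH => k kn; apply: mu; exact: leqW.
Qed.

(** Applied to the space endowed with the k-th sigma-algebra of the filtration,
    this says that the integrand is adapted. *)
Lemma measurable_weight (r : R) (Q M : nat -> T -> R) k :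
  measurable_fun [set: T] (Q k) ->
  (forall j, (j <= k)%N -> measurable_fun [set: T] (M j)) ->
  measurable_fun [set: T] (fun x => weight r (Q ^~ x) (M ^~ x) k).
Proof.
move=> mQ mM; apply: measurable_funD; apply: measurable_funM => //.
  exact: measurable_spow.
apply: measurable_funM.
  apply: (measurableT_comp (measurable_powR _)).
  apply: (measurable_runmax (u := fun j x => `|M j x|)) => j jk.
  by apply: measurableT_comp => //; exact: mM.
under eq_fun do rewrite sgE_spow.
by apply: measurable_spow; exact: mM.
Qed.

Lemma measurable_esup_seq (X : nat -> T -> R) :
  (forall n, measurable_fun [set: T] (X n)) ->
  measurable_fun [set: T] (esup_seq X).
Proof.
move=> mX.
have -> : esup_seq X = (fun x => esups (fun n => (X n x)%:E) 0%N).
  apply/funext => x; rewrite /esup_seq /esups; congr ereal_sup.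
  by apply/seteqP; split => [_ [n _ <-]|_ [n _ <-]]; exists n.
apply: (measurable_fun_esups (f := fun n x => (X n x)%:E)) => n.
exact/measurable_EFinP.
Qed.

End meas.

(** * Moment bound up to a finite horizon *)

Section finite_horizon.
Context d (T : measurableType d) (R : realType) (P : probability T R).

Lemma ae_le_integrable (f g : T -> R) : measurable_fun [set: T] f ->
  {ae P, forall x, `|f x| <= g x} -> P.-integrable [set: T] (EFin \o g) ->
  P.-integrable [set: T] (EFin \o f).
Proof.
move=> mf fg ig; apply/integrableP; split; first exact/measurable_EFinP.
have /integrableP[mg] := ig; apply: le_lt_trans.
apply: ae_ge0_le_integral => //.
- by apply: measurableT_comp => //; exact/measurable_EFinP.
- exact: measurableT_comp.
- by apply: filterS fg => x fgx _; rewrite /= lee_fin (le_trans fgx)// ler_norm.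
Qed.

Context (F : nat -> set (set T)) (Q1 Q2 H : nat -> T -> R).
Context (filF : filtration F) (aQ1 : adapted F Q1) (aQ2 : adapted F Q2).
Let Q := fun n x => Q1 n x - Q2 n x.
Let M := fun n x => H n x + Q n x.
Context (martM : martingale P F M).

(** The almost sure hypotheses at one outcome, with the suprema replaced by
    real-valued upper bounds; this keeps infinite values out of the
    finite-horizon estimate. *)
Definition bounded_path (z y w : T -> R) x :=
  [/\ forall n, 0 <= Q1 n x /\ 0 <= Q2 n x,
      forall n, Q1 n x <= Q1 n.+1 x /\ Q2 n x <= Q2 n.+1 x,
      H 0%N x + Q 0%N x = 0 &
      [/\ forall n, `|H n x| <= z x,
          forall n, Q1 n.+1 x - Q1 n x + (Q2 n.+1 x - Q2 n x) <= y x &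
          forall n, Q1 n x + Q2 n x <= w x]].

Lemma adapted_le X j k :
  adapted F X -> (j <= k)%N -> measurable_wrt (F k) (X j : T -> R).
Proof.
move=> aX jk; have [sF _ ndF] := filF.
exact: (measurable_wrt_sub (sF j) (sF k) (ndF _ _ jk)).
Qed.

Lemma adapted_measurable X k :
  adapted F X -> measurable_fun [set: T] (X k : T -> R).
Proof.
move=> aX; have [sF Fm _] := filF.
exact: (measurable_wrt_measurable (sF k) (Fm k)).
Qed.

Lemma adaptedQ : adapted F Q.
Proof. by move=> k; apply: measurable_funB; [exact: aQ1|exact: aQ2]. Qed.

Lemma adaptedM : adapted F M. Proof. by case: martM. Qed.

Lemma adaptedH : adapted F H.
Proof.
move=> k.
have -> : H k = fun x => M k x - Q k x by apply/funext => x; rewrite /M addrK.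
by apply: measurable_funB; [exact: adaptedM|exact: adaptedQ].
Qed.

Lemma bounded_pathP z y w x : bounded_path z y w x ->
  [/\ 0 <= z x, 0 <= y x /\ 0 <= w x, forall n, `|Q n x| <= w x,
      (forall n, `|Q n.+1 x - Q n x| <= y x) &
      forall N, \sum_(k < N) `|Q k.+1 x - Q k x| <= w x].
Proof.
move=> [ge0 nd _ [hz hy hw]]; split.
- exact: le_trans (normr_ge0 _) (hz 0%N).
- split; first by have := hy 0%N; have [] := nd 0%N; lra.
  by have := hw 0%N; have [] := ge0 0%N; lra.
- move=> n; rewrite (le_trans (ler_normB _ _))// !ger0_norm; by case: (ge0 n).
- move=> n; have [h1 h2] := nd n.
  rewrite /Q (_ : _ - _ - _ =
    (Q1 n.+1 x - Q1 n x) - (Q2 n.+1 x - Q2 n x)); last by ring.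
  rewrite (le_trans (ler_normB _ _))// !ger0_norm ?subr_ge0//; exact: hy.
- move=> N; apply: le_trans (hw N).
  exact: (@total_variation_le _ (Q1 ^~ x) (Q2 ^~ x)).
Qed.

(** The expectation of [pathwise_bound].  The bounds z, y and w do not depend on
    the horizon N, which can therefore tend to infinity afterwards. *)
Lemma integral_max_bound (z y w : T -> R) (p : R) N : 1 < p ->
  measurable_fun [set: T] z -> measurable_fun [set: T] y ->
  measurable_fun [set: T] w ->
  (forall x, 0 <= z x) -> (forall x, 0 <= y x) -> (forall x, 0 <= w x) ->
  P.-integrable [set: T] (fun x => (z x `^ (2 * p))%:E) ->
  P.-integrable [set: T] (fun x => (y x `^ (2 * p))%:E) ->
  P.-integrable [set: T] (fun x => (w x `^ (2 * p))%:E) ->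
  {ae P, forall x, bounded_path z y w x} ->
  (\int[P]_x (runmax (fun k => `|Q k x|) N `^ (2 * p))%:E <=
    (moment_const p)%:E * (\int[P]_x (z x `^ (2 * p))%:E +
     (\int[P]_x (z x `^ (2 * p))%:E) `^ (2^-1) *
      (\int[P]_x (w x `^ (2 * p))%:E) `^ (2^-1) +
     (\int[P]_x (y x `^ (2 * p))%:E) `^ (2^-1) *
      (\int[P]_x (w x `^ (2 * p))%:E) `^ (2^-1)))%E.
Proof.
move=> p1 mz my mw z0 y0 w0 iz iy iw good.
have p0 : 0 < p by lra.
have r1 : 1 < 2 * p by lra.
pose r := 2 * p; rewrite -/r in r1 iz iy iw *.
have r0 : 0 < r by rewrite /r; lra.
have mpow (f : T -> R) s : measurable_fun [set: T] f ->
    measurable_fun [set: T] (fun x => f x `^ s).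
  by move=> mf; exact: (measurableT_comp (measurable_powR _)).
have mQ k := adapted_measurable k adaptedQ.
have mM k := adapted_measurable k adaptedM.
have mS : measurable_fun [set: T] (fun x => runmax (fun k => `|Q k x|) N).
  apply: (measurable_runmax (u := fun j x => `|Q j x|)) => j _.
  exact: measurableT_comp.
pose b x := z x + w x.
have mb : measurable_fun [set: T] b by exact: measurable_funD.
have ib : P.-integrable [set: T] (EFin \o (fun x => b x `^ r)).
  apply: (@ae_le_integrable _ (fun x => 2 `^ r * (z x `^ r + w x `^ r))).
  - exact: mpow.
  - apply: aeW => x; rewrite ger0_norm ?powR_ge0// powRD_le//; exact: ltW.
  - have := integrableZl measurableT (2 `^ r) (integrableD measurableT iz iw).
    by apply: eq_integrable => // x _; rewrite /= EFinM EFinD.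
have icross (f g : T -> R) :
    measurable_fun [set: T] f -> measurable_fun [set: T] g ->
    (forall x, 0 <= f x) -> (forall x, 0 <= g x) ->
    P.-integrable [set: T] (fun x => (f x `^ r)%:E) ->
    P.-integrable [set: T] (fun x => (g x `^ r)%:E) ->
    P.-integrable [set: T] (EFin \o (fun x => (f x * g x) `^ p)).
  move=> mf mg f0 g0 jf jg.
  apply: (@ae_le_integrable _ (fun x => f x `^ r + g x `^ r)).
  - by apply: mpow; exact: measurable_funM.
  - apply: aeW => x; rewrite ger0_norm ?powR_ge0// powRM//.
    by have := powR_mix (f0 x) (g0 x) (ltW p0) p0; rewrite /r mulr_natl mulr2n.
  - have := integrableD measurableT jf jg.
    by apply: eq_integrable => // x _; rewrite /= EFinD.
have izw := icross z w mz mw z0 w0 iz iw.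
have iyw := icross y w my mw y0 w0 iy iw.
pose g k x := weight r (Q ^~ x) (M ^~ x) k.
have ag k : measurable_wrt (F k) (g k).
  apply: (measurable_weight (T := g_sigma_algebraType (F k))).
    exact: adaptedQ.
  by move=> j jk; exact: (adapted_le adaptedM jk).
have ig k : P.-integrable [set: T] (fun x => (g k x * (M k.+1 x - M k x))%:E).
  apply: (@ae_le_integrable _ (fun x =>
      2 * (8 * expR 1 ^+ 2 * r + 8 * r * expR 1) * b x `^ r)).
  - apply: measurable_funM; last exact: measurable_funB.
    by apply: measurable_weight => // j _.
  - apply: filterS good => x gx; have [_ _ Qw _ _] := bounded_pathP gx.
    have [_ _ _ [hz _ _]] := gx.
    apply: weight_le => // j _; first by rewrite (le_trans (Qw j))// lerDr.
    by rewrite (le_trans (ler_normD _ _))// lerD// ?hz ?Qw.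
  - have := integrableZl measurableT
      (2 * (8 * expR 1 ^+ 2 * r + 8 * r * expR 1)) ib.
    by apply: eq_integrable => // x _; rewrite /= EFinM.
have [itr tr0] := integral_transform filF martM ag (fun k _ => ig k) (N := N).
pose tr x := transform (g ^~ x) (M ^~ x) N.
rewrite -/(tr _) in itr tr0.
pose V x := z x `^ r + ((z x * w x) `^ p + (y x * w x) `^ p).
have iV : P.-integrable [set: T] (EFin \o V).
  have := integrableD measurableT iz (integrableD measurableT izw iyw).
  by apply: eq_integrable => // x _; rewrite /= !EFinD.
have c0 : 0 <= moment_const p.
  by rewrite /moment_const mulr_ge0 ?powR_ge0 ?pathwise_const_ge0.
have V0 x : 0 <= V x by rewrite /V !addr_ge0 ?powR_ge0.
have key : {ae P, forall x,
    runmax (fun k => `|Q k x|) N `^ r <= moment_const p * V x + tr x}.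
  apply: filterS good => x gx; have [_ _ Qw Qy Qtv] := bounded_pathP gx.
  have [_ _ H0 [hz _ _]] := gx.
  have := @pathwise_bound _ p (Q ^~ x) (H ^~ x) (M ^~ x) N
    (z x) (y x) (w x) p1 (y0 x)
    (fun=> erefl) (fun k _ => hz k) (fun k _ => Qy k) (Qtv N) H0.
  rewrite -/r => /le_trans; apply; rewrite lerD2r /moment_const -/r.
  rewrite -[leRHS]mulrA ler_wpM2l ?pathwise_const_ge0// /V mulrDr lerD//.
    have two1 : 1 <= 2 :> R by rewrite ler1n.
    have := ler_powR two1 (ltW p0); rewrite powRr0 => two1p.
    by rewrite ler_peMl ?powR_ge0.
  by rewrite mulrDl powRD_le ?mulr_ge0// ltW.
have iR : P.-integrable [set: T]
    (fun x => (moment_const p)%:E * (V x)%:E + (tr x)%:E)%E.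
  by apply: integrableD => //; exact: integrableZl.
have E1 : (\int[P]_x ((moment_const p)%:E * (V x)%:E + (tr x)%:E) =
    (moment_const p)%:E * \int[P]_x (V x)%:E)%E.
  rewrite integralD//; last exact: integrableZl.
  by rewrite tr0 adde0 integralZl.
have E2 : (\int[P]_x (V x)%:E = \int[P]_x (z x `^ r)%:E +
   (\int[P]_x ((z x * w x) `^ p)%:E + \int[P]_x ((y x * w x) `^ p)%:E))%E.
  rewrite -integralD// -integralD//; last exact: integrableD.
have mR := measurable_int _ iR.
apply: (@le_trans _ _ ((moment_const p)%:E * \int[P]_x (V x)%:E)%E).
  (* The upper bound is nonnegative only almost surely, whereas comparison of
     integrals wants nonnegativity everywhere: pass to its absolute value. *)
  have E3 : (\int[P]_x ((moment_const p)%:E * (V x)%:E + (tr x)%:E) =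
      \int[P]_x `|(moment_const p)%:E * (V x)%:E + (tr x)%:E|)%E.
    apply: ae_eq_integral => //; first exact: measurableT_comp.
    apply: filterS key => x kx _; rewrite gee0_abs// -EFinM -EFinD lee_fin.
    exact: le_trans (powR_ge0 _ _) kx.
  rewrite -E1 E3; apply: ae_ge0_le_integral => //.
  - by move=> x _; rewrite lee_fin powR_ge0.
  - by apply/measurable_EFinP; exact: mpow.
  - exact: measurableT_comp.
  - apply: filterS key => x kx _; apply: le_trans (lee_abs _).
    by rewrite -EFinM -EFinD lee_fin.
rewrite E2 lee_wpmul2l ?lee_fin// -addeA leeD2l// leeD//.
  exact: cauchy_schwarz_powR.
exact: cauchy_schwarz_powR.
Qed.

End finite_horizon.

(** * Suprema and infinite moments *)

Section esup.
Context {R : realType}.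

Lemma le_esup_seq (T : Type) (X : nat -> T -> R) n x :
  ((X n x)%:E <= esup_seq X x)%E.
Proof. by apply: ereal_sup_ubound; exists n. Qed.

Lemma esup_seq_le (T : Type) (X : nat -> T -> R) x c :
  (forall n, ((X n x)%:E <= c)%E) -> (esup_seq X x <= c)%E.
Proof. by move=> h; apply: ge_ereal_sup => _ [n _ <-]. Qed.

Lemma poweR_mono (r : R) (a b : \bar R) : 0 <= r -> (0 <= a)%E -> (a <= b)%E ->
  (a `^ r <= b `^ r)%E.
Proof.
move=> r0 a0 ab; apply: gt0_ler_poweR => //.
  by rewrite in_itv/= a0 leey.
by rewrite in_itv/= (le_trans a0 ab) leey.
Qed.

(** Both sides are the supremum of the increasing sequence on the right; the
    identity carries the power through the supremum. *)
Lemma esup_seq_powR (T : Type) (X : nat -> T -> R) (r : R) x : 0 < r ->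
  (forall n, 0 <= X n x) ->
  (esup_seq X x `^ r = limn (fun N => (runmax (X ^~ x) N `^ r)%:E))%E.
Proof.
move=> r0 X0; set u := fun N => _.
have m0 N : 0 <= runmax (X ^~ x) N by exact: runmax_ge0.
have ndu : nondecreasing_seq u.
  move=> m n mn; rewrite lee_fin ge0_ler_powR ?nnegrE ?(ltW r0)//.
  exact: (runmax_nd (X ^~ x)).
rewrite (cvg_lim _ (ereal_nondecreasing_cvgn ndu))//.
apply/eqP; rewrite eq_le; apply/andP; split.
  have s0 : (0 <= ereal_sup (range u))%E.
    apply: le_trans (ereal_sup_ubound _); last by exists 0%N.
    by rewrite lee_fin powR_ge0.
  have -> : ereal_sup (range u) = (ereal_sup (range u) `^ (r^-1) `^ r)%E.
    by rewrite -poweRrM mulVf ?gt_eqF// poweRe1.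
  apply: poweR_mono; first exact: ltW.
    by apply: le_trans (le_esup_seq X 0%N x); rewrite lee_fin.
  apply: esup_seq_le => n.
  have -> : (X n x)%:E = (((X n x) `^ r)%:E `^ r^-1)%E.
    by rewrite poweR_EFin -powRrM divff ?gt_eqF// powRr1.
  apply: poweR_mono; rewrite ?invr_ge0 ?(ltW r0) ?lee_fin ?powR_ge0//.
  apply: (@le_trans _ _ (u n)); last by apply: ereal_sup_ubound; exists n.
  rewrite lee_fin ge0_ler_powR ?nnegrE ?(ltW r0)//.
  exact: (le_runmax (X ^~ x)).
apply: ge_ereal_sup => _ [N _ <-].
rewrite /u -poweR_EFin; apply: poweR_mono; rewrite ?(ltW r0) ?lee_fin//.
have [n _ ->] : exists2 n, (n <= N)%N & runmax (X ^~ x) N = X n x.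
  elim: N => [|N [n nN IH]]; first by exists 0%N.
  rewrite /=; case: (leP (runmax (X ^~ x) N) (X N.+1 x)) => _.
    by exists N.+1.
  by exists n => //; exact: leqW.
exact: le_esup_seq.
Qed.

End esup.

Section moments.
Context d (T : measurableType d) (R : realType) (P : probability T R).

Lemma integral_esup_le (X : nat -> T -> R) (r : R) B : 0 < r ->
  (forall n, measurable_fun [set: T] (X n)) -> (forall n x, 0 <= X n x) ->
  (forall N, (\int[P]_x (runmax (X ^~ x) N `^ r)%:E <= B)%E) ->
  (\int[P]_x (esup_seq X x `^ r) <= B)%E.
Proof.
move=> r0 mX X0 hB.
have m0 N x : 0 <= runmax (X ^~ x) N by exact: runmax_ge0.
under eq_integral do rewrite esup_seq_powR//.
rewrite monotone_convergence//.
- apply: lime_le; last by apply: nearW.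
  apply: ereal_nondecreasing_is_cvgn => m n mn; apply: ge0_le_integral => //.
  + by move=> x _; rewrite lee_fin powR_ge0.
  + apply/measurable_EFinP; apply: (measurableT_comp (measurable_powR _)).
    by apply: measurable_runmax => k _.
  + apply/measurable_EFinP; apply: (measurableT_comp (measurable_powR _)).
    by apply: measurable_runmax => k _.
  + move=> x _; rewrite lee_fin ge0_ler_powR ?nnegrE ?(ltW r0)//.
    exact: (runmax_nd (X ^~ x)).
- move=> N; apply/measurable_EFinP; apply: (measurableT_comp (measurable_powR _)).
  by apply: measurable_runmax => k _.
- by move=> N x _; rewrite lee_fin powR_ge0.
- move=> x _ m n mn; rewrite lee_fin ge0_ler_powR ?nnegrE ?(ltW r0)//.
  exact: (runmax_nd (X ^~ x)).
Qed.

(** A finite moment allows the replacement of an extended real-valued variable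
    by a real-valued one; the absolute value makes it nonnegative everywhere. *)
Lemma finite_moment (f : T -> \bar R) (r : R) : 0 < r ->
  measurable_fun [set: T] f -> {ae P, forall x, (0 <= f x)%E} ->
  (\int[P]_x (f x `^ r) < +oo)%E ->
  [/\ measurable_fun [set: T] (fun x => `|fine (f x)|),
      P.-integrable [set: T] (fun x => (`|fine (f x)| `^ r)%:E),
      (\int[P]_x (`|fine (f x)| `^ r)%:E = \int[P]_x (f x `^ r))%E &
      {ae P, forall x, f x = `|fine (f x)|%:E}].
Proof.
move=> r0 mf f0 foo.
have mfr : measurable_fun [set: T] (fun x => f x `^ r)%E.
  exact: (measurableT_comp (measurable_poweR _)).
have ifr : P.-integrable [set: T] (fun x => f x `^ r)%E.
  apply/integrableP; split=> //.
  by under eq_integral do rewrite gee0_abs ?poweR_ge0//.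
have mff : measurable_fun [set: T] (fun x => `|fine (f x)|).
  by apply: measurableT_comp => //; exact: measurableT_comp.
have ff : {ae P, forall x, f x = `|fine (f x)|%:E}.
  apply: filterS2 f0 (integrable_ae measurableT ifr) => x fx0 /(_ Logic.I) fin.
  have fx : f x \is a fin_num.
    rewrite ge0_fin_numE//; apply: (@lty_poweRy _ _ r); first by rewrite gt_eqF.
    by move: fin; rewrite ge0_fin_numE ?poweR_ge0.
  by rewrite ger0_norm ?fine_ge0// fineK.
have e : (\int[P]_x (`|fine (f x)| `^ r)%:E = \int[P]_x (f x `^ r))%E.
  apply: ae_eq_integral => //.
    by apply/measurable_EFinP; exact: (measurableT_comp (measurable_powR _)).
  by apply: filterS ff => x {2}-> _; rewrite poweR_EFin.
split=> //; apply/integrableP; split.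
  by apply/measurable_EFinP; exact: (measurableT_comp (measurable_powR _)).
under eq_integral do rewrite gee0_abs ?lee_fin ?powR_ge0//.
by rewrite e.
Qed.

Lemma zero_moment (f : T -> \bar R) (r : R) : 0 < r ->
  measurable_fun [set: T] f -> {ae P, forall x, (0 <= f x)%E} ->
  (\int[P]_x (f x `^ r) = 0)%E -> {ae P, forall x, f x = 0%E}.
Proof.
move=> r0 mf f0 e.
have foo : (\int[P]_x (f x `^ r) < +oo)%E by rewrite e.
have mfr : measurable_fun [set: T] (fun x => f x `^ r)%E.
  exact: (measurableT_comp (measurable_poweR _)).
have /(ae_eq_integral_abs P measurableT mfr) : (\int[P]_x `|f x `^ r| = 0)%E.
  by under eq_integral do rewrite gee0_abs ?poweR_ge0//.
apply: filterS2 f0 => x fx0 /(_ Logic.I) /eqP.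
by rewrite poweR_eq0// => /andP[/eqP].
Qed.

End moments.

(** * The inequality *)

Unset Implicit Arguments.
Theorem proposition3p2 (R : realType) :
  exists c : R,
  forall (d : measure_display) (T : measurableType d) (P : probability T R)
    (F : nat -> set (set T)) (Q1 Q2 H : nat -> T -> R),
  filtration F ->
  adapted F Q1 -> adapted F Q2 ->
  {ae P, forall x, forall n, 0 <= Q1 n x /\ 0 <= Q2 n x} ->
  {ae P, forall x, forall n, Q1 n x <= Q1 n.+1 x /\ Q2 n x <= Q2 n.+1 x} ->
  let Q := fun n x => Q1 n x - Q2 n x in
  martingale P F (fun n x => H n x + Q n x) ->
  {ae P, forall x, H 0%N x + Q 0%N x = 0} ->
  let Z := esup_seq (fun n x => `|H n x|) in
  let Y := esup_seq
    (fun n x => (Q1 n.+1 x - Q1 n x) + (Q2 n.+1 x - Q2 n x)) in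
  let W := fun x => (esup_seq Q1 x + esup_seq Q2 x)%E in
  forall p : R, 1 < p ->
  (\int[P]_x (esup_seq (fun n y => `|Q n y|%R) x `^ (2 * p)) <=
   (c * p `^ (4 * p))%R%:E *
   (\int[P]_x (Z x `^ (2 * p)) +
    (\int[P]_x (Z x `^ (2 * p))) `^ (2^-1) *
      (\int[P]_x (W x `^ (2 * p))) `^ (2^-1) +
    (\int[P]_x (Y x `^ (2 * p))) `^ (2^-1) *
      (\int[P]_x (W x `^ (2 * p))) `^ (2^-1)))%E.
Proof.
pose c : R := 2 * (4 * expR 1 ^+ 2 + expR 1 + 2) *
  expR (2 * (32 * expR 1 ^+ 2) ^+ 2).
exists c => d T P F Q1 Q2 H filF aQ1 aQ2 ge0 nd Q mart init Z Y W p p1.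
have p0 : 0 < p by lra.
set r := 2 * p; have r0 : 0 < r by rewrite /r; lra.
have c0 : 0 < c.
  have E0 : 0 < expR 1 :> R by exact: expR_gt0.
  have E2 : 0 < expR 1 ^+ 2 :> R by exact: exprn_gt0.
  by rewrite /c mulr_gt0 ?expR_gt0// mulr_gt0// !addr_gt0// mulr_gt0.
have cp0 : (0 < (c * p `^ (4 * p))%:E)%E by rewrite lte_fin mulr_gt0 ?powR_gt0.
have mQ n : measurable_fun [set: T] (Q n) :=
  adapted_measurable filF n (adaptedQ aQ1 aQ2).
have mH n := adapted_measurable filF n (adaptedH aQ1 aQ2 mart).
have mQ1 n := adapted_measurable filF n aQ1.
have mQ2 n := adapted_measurable filF n aQ2.
have mZ : measurable_fun [set: T] Z.
  by apply: measurable_esup_seq => n; exact: measurableT_comp.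
have mY : measurable_fun [set: T] Y.
  apply: measurable_esup_seq => n.
  by apply: measurable_funD; exact: measurable_funB.
have mW : measurable_fun [set: T] W.
  by apply: emeasurable_funD; exact: measurable_esup_seq.
have Z0 x : (0 <= Z x)%E.
  by apply: le_trans (le_esup_seq _ 0%N x); rewrite lee_fin.
have good : {ae P, forall x, [/\ forall n, 0 <= Q1 n x /\ 0 <= Q2 n x,
    forall n, Q1 n x <= Q1 n.+1 x /\ Q2 n x <= Q2 n.+1 x &
    H 0%N x + Q 0%N x = 0]}.
  by apply: filterS3 ge0 nd init => x.
have Y0 : {ae P, forall x, (0 <= Y x)%E}.
  apply: filterS good => x [_ ndx _]; apply: le_trans (le_esup_seq _ 0%N x).
  by have [h1 h2] := ndx 0%N; rewrite lee_fin addr_ge0 ?subr_ge0.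
have QW x n : ((Q1 n x + Q2 n x)%:E <= W x)%E.
  by rewrite EFinD; apply: leeD; exact: le_esup_seq.
have W0 : {ae P, forall x, (0 <= W x)%E}.
  apply: filterS good => x [gx _ _]; apply: le_trans (QW x 0%N).
  by have [h1 h2] := gx 0%N; rewrite lee_fin addr_ge0.
have YW : {ae P, forall x, (Y x <= W x)%E}.
  apply: filterS good => x [gx _ _]; apply: esup_seq_le => n.
  by apply: le_trans (QW x n.+1); have [h1 h2] := gx n; rewrite lee_fin; lra.
set IZ := (\int[P]_x (Z x `^ r))%E; set IY := (\int[P]_x (Y x `^ r))%E.
set IW := (\int[P]_x (W x `^ r))%E.
have IZ0 : (0 <= IZ)%E by apply: integral_ge0 => x _; exact: poweR_ge0.
have IY0 : (0 <= IY)%E by apply: integral_ge0 => x _; exact: poweR_ge0.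
have IW0 : (0 <= IW)%E by apply: integral_ge0 => x _; exact: poweR_ge0.
have prod0 (a b : \bar R) : (0 <= a `^ 2^-1 * b `^ 2^-1)%E.
  by rewrite mule_ge0 ?poweR_ge0.
have sum0 : (0 <= IZ + IZ `^ 2^-1 * IW `^ 2^-1 + IY `^ 2^-1 * IW `^ 2^-1)%E.
  by apply: adde_ge0; [apply: adde_ge0|].
have Ny (a : \bar R) : (0 <= a)%E -> (a != -oo)%E.
  by move=> a0; rewrite gt_eqF// (lt_le_trans _ a0).
have [IZoo|IZoo] := eqVneq IZ +oo%E.
  rewrite [in leRHS]IZoo addye; last exact: Ny.
  by rewrite addye ?gt0_muley ?leey//; exact: Ny.
have {}IZoo : (IZ < +oo)%E by rewrite ltey.
(* The product of zero and infinity is zero, so an infinite IW makes the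
   right-hand side infinite only if IZ or IY is nonzero. *)
have [IWoo|IWoo] := eqVneq IW +oo%E.
  have pos (a : \bar R) :
      (0 <= a)%E -> a != 0%E -> (a `^ 2^-1 * IW `^ 2^-1 = +oo)%E.
    by move=> a0 an0; rewrite IWoo poweRyr// gt0_muley// poweR_gt0// lt0e an0.
  have [IZz|IZz] := eqVneq IZ 0%E; last first.
    rewrite (pos _ IZ0 IZz) addey; last exact: Ny.
    by rewrite addye ?gt0_muley ?leey//; exact: Ny.
  have [IYz|IYz] := eqVneq IY 0%E; last first.
    rewrite (pos _ IY0 IYz) addey; last by apply: Ny; exact: adde_ge0.
    by rewrite gt0_muley ?leey.
  have Zz := zero_moment r0 mZ (aeW _ Z0) IZz.
  have Yz := zero_moment r0 mY Y0 IYz.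
  have mS : measurable_fun [set: T] (esup_seq (fun n y => `|Q n y|)).
    by apply: measurable_esup_seq => n; exact: measurableT_comp.
  have -> : (\int[P]_x (esup_seq (fun n y => `|Q n y|%R) x `^ r) = 0)%E.
    rewrite -[RHS](integral0 P setT); apply: ae_eq_integral => //.
      exact: (measurableT_comp (measurable_poweR _)).
    apply: filterS3 good Zz Yz => x [gx ndx ix] zx yx _.
    have Q0 n : Q n x = 0.
      elim: n => [|n IH].
        have := le_esup_seq (fun n x => `|H n x|) 0%N x.
        by rewrite -/Z zx lee_fin normr_le0 => /eqP h0; rewrite h0 add0r in ix.
      have := le_esup_seq
        (fun n x => Q1 n.+1 x - Q1 n x + (Q2 n.+1 x - Q2 n x)) n x.
      by rewrite -/Y yx lee_fin; have := ndx n; move: IH; rewrite /Q; lra.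
    rewrite (_ : esup_seq _ x = 0%E) ?poweR0r ?gt_eqF//.
    apply/eqP; rewrite eq_le; apply/andP; split.
      by apply: esup_seq_le => n; rewrite Q0 normr0.
    by apply: le_trans (le_esup_seq _ 0%N x); rewrite lee_fin.
  by apply: mule_ge0; [exact: ltW|exact: sum0].
have {}IWoo : (IW < +oo)%E by rewrite ltey.
have IYoo : (IY < +oo)%E.
  apply: le_lt_trans IWoo; apply: ae_ge0_le_integral => //.
  - by move=> x _; exact: poweR_ge0.
  - exact: (measurableT_comp (measurable_poweR _)).
  - by move=> x _; exact: poweR_ge0.
  - exact: (measurableT_comp (measurable_poweR _)).
  - by apply: filterS2 Y0 YW => x y0 yw _; apply: poweR_mono => //; exact: ltW.
have [mz iz ez fz] := finite_moment r0 mZ (aeW _ Z0) IZoo.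
have [my iy ey fy] := finite_moment r0 mY Y0 IYoo.
have [mw iw ew fw] := finite_moment r0 mW W0 IWoo.
apply: integral_esup_le => //.
  by move=> n; exact: measurableT_comp.
move=> N.
have := integral_max_bound filF aQ1 aQ2 mart N p1 mz my mw
  (fun=> normr_ge0 _) (fun=> normr_ge0 _) (fun=> normr_ge0 _) iz iy iw.
rewrite -/r ez ey ew -/IZ -/IY -/IW => bnd.
apply: le_trans (bnd _) _; last first.
  rewrite lee_wpmul2r// lee_fin; exact: moment_const_le.
have fzy : {ae P, forall x, Z x = `|fine (Z x)|%:E /\ Y x = `|fine (Y x)|%:E}.
  by apply: filterS2 fz fy.
apply: filterS3 good fzy fw => x [gx ndx ix] [zx yx] wx; split=> //; split=> n.
- by rewrite -lee_fin -zx; exact: (le_esup_seq (fun n x => `|H n x|)).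
- rewrite -lee_fin -yx; exact: (le_esup_seq
    (fun n x => Q1 n.+1 x - Q1 n x + (Q2 n.+1 x - Q2 n x))).
- by rewrite -lee_fin -wx.
Qed.
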